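(* Let $\mathbf{k}$ be a field and $B$ an affine $\mathbf{k}$-domain. Then $\mathcal{X}_{\mathbf{k}}(B)$ has nonempty interior if and only if $\mathrm{Frac}(B)/\mathbf{k}\in\mathrm{PE}_{\mathbf{k}}(B)$.
   Context: Rings are commutative with unity, and $0\in\mathbb{N}$. An affine $\mathbf{k}$-domain is an integral domain that is a finitely generated $\mathbf{k}$-algebra. The field $\mathbf{k}$ is arbitrary. For a $\mathbf{k}$-algebra $B$ and a field extension $K/\mathbf{k}$, write $K/\mathbf{k}\in\mathrm{PE}_{\mathbf{k}}(B)$ if, for some $n\in\mathbb{N}$, there exists an injective homomorphism of $K$-algebras from $K\otimes_{\mathbf{k}}B$ to a polynomial ring in $n$ variables over $K$. Define $\mathcal{X}_{\mathbf{k}}(B)=\{\mathfrak{p}\in\mathrm{Spec}\,B\mid \kappa(\mathfrak{p})/\mathbf{k}\in\mathrm{PE}_{\mathbf{k}}(B)\}$, where $\kappa(\mathfrak{p})=B_{\mathfrak{p}}/\mathfrak{p}B_{\mathfrak{p}}$. One says that $\mathcal{X}_{\mathbf{k}}(B)$ has nonempty interior if some nonempty Zariski-open subset of $\mathrm{Spec}\,B$ is included in it. *)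

(* Defs.v *)
From HB Require Import structures.
From mathcomp Require Import all_boot all_order all_algebra.
From mathcomp Require Import boolp classical_sets.
From mathcomp Require Import mpoly.

Set Implicit Arguments.
Unset Strict Implicit.
Unset Printing Implicit Defensive.

Import GRing.Theory.
Local Open Scope ring_scope.
Local Open Scope quotient_scope.
Local Open Scope classical_set_scope.

(* A commutative k-algebra is a commutative ring B with its structure
   morphism k -> B; a field extension K/k is a field K with a morphism k -> K.
   A homomorphism of k-algebras is a ring morphism under k. *)

(* The tensor product K (x)_k B: finite formal sums of pairs (a, b), modulo
   the least additive congruence making (a, b) |-> [:: (a, b)] k-bilinear.
   Opposites come from -(a (x) b) = (- a) (x) b. *)
Section Tensor.
Variables (k K B : comNzRingType).
Variables (iota : {rmorphism k -> K}) (phi : {rmorphism k -> B}).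
Implicit Types (s t : seq (K * B)).

Inductive tensor_eq : seq (K * B) -> seq (K * B) -> Prop :=
| teq_refl s : tensor_eq s s
| teq_sym s t : tensor_eq s t -> tensor_eq t s
| teq_trans s t u : tensor_eq s t -> tensor_eq t u -> tensor_eq s u
| teq_cat s s' t t' :
    tensor_eq s s' -> tensor_eq t t' -> tensor_eq (s ++ t) (s' ++ t')
| teq_catC s t : tensor_eq (s ++ t) (t ++ s)
| teq_Dl a a' b : tensor_eq [:: (a + a', b)] [:: (a, b); (a', b)]
| teq_Dr a b b' : tensor_eq [:: (a, b + b')] [:: (a, b); (a, b')]
| teq_Z c a b : tensor_eq [:: (iota c * a, b)] [:: (a, phi c * b)]
| teq_0 b : tensor_eq [:: (0, b)] [::].

Definition tensor_eqb s t : bool := `[< tensor_eq s t >].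

Lemma tensor_eqb_equiv : equiv_class_of tensor_eqb.
Proof.
split=> [s|s t|t s u].
- by apply/asboolP; apply: teq_refl.
- by apply/asboolP/asboolP; apply: teq_sym.
- by move=> /asboolP st /asboolP tu; apply/asboolP; apply: teq_trans st tu.
Qed.

Canonical tensor_equiv := EquivRelPack tensor_eqb_equiv.
Canonical tensor_encModRel := defaultEncModRel tensor_eqb.

Definition tensor := {eq_quot tensor_eqb}.
HB.instance Definition _ : EqQuotient _ tensor_eqb tensor :=
  EqQuotient.on tensor.
HB.instance Definition _ := Choice.on tensor.

Lemma tensorP s t : \pi_tensor s = \pi_tensor t <-> tensor_eq s t.
Proof.
split=> [/eqmodP/asboolP//|st]; by apply/eqmodP/asboolP.
Qed.

Definition fsum_opp s : seq (K * B) := [seq (- x.1, x.2) | x <- s].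
Definition fsum_mul s t : seq (K * B) :=
  [seq (x.1 * y.1, x.2 * y.2) | x <- s, y <- t].

Lemma teq_perm s t : perm_eq s t -> tensor_eq s t.
Proof.
elim: s t => [|x s IHs] t.
  by rewrite perm_sym => /perm_nilP ->; apply: teq_refl.
move=> st; have xt : x \in t by rewrite -(perm_mem st) mem_head.
case/splitPr: xt st => t1 t2.
rewrite -[x :: s]cat1s -[x :: t2]cat1s => st.
have /IHs {}st : perm_eq s (t1 ++ t2).
  by move: st; rewrite perm_sym perm_catCA perm_cat2l perm_sym.
apply: teq_trans (teq_cat (teq_refl _) st) _; rewrite !catA.
exact: teq_cat (teq_catC _ _) (teq_refl _).
Qed.

Lemma fsum_mul_cons s y t :
  perm_eq (fsum_mul s (y :: t))
          ([seq (x.1 * y.1, x.2 * y.2) | x <- s] ++ fsum_mul s t).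
Proof. by apply/permPl/(perm_allpairs_consr _ s (fun=> y) (fun=> t)). Qed.

Lemma fsum_mulDl s1 s2 t :
  fsum_mul (s1 ++ s2) t = fsum_mul s1 t ++ fsum_mul s2 t.
Proof. exact: allpairs_cat. Qed.

Lemma fsum_mulC s t : perm_eq (fsum_mul s t) (fsum_mul t s).
Proof.
elim: s => [|x s IHs]; first by elim: t.
rewrite perm_sym; apply: perm_trans (fsum_mul_cons _ _ _) _.
rewrite perm_sym -[x :: s]cat1s fsum_mulDl perm_cat // /fsum_mul allpairs1l.
by under eq_map => y do rewrite mulrC [x.2 * _]mulrC.
Qed.

Lemma fsum_mulA s t u :
  perm_eq (fsum_mul s (fsum_mul t u)) (fsum_mul (fsum_mul s t) u).
Proof.
have E z w v : fsum_mul (z :: w) v =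
    [seq (z.1 * y.1, z.2 * y.2) | y <- v] ++ fsum_mul w v by [].
elim: s => [|x s IHs] //.
rewrite !E fsum_mulDl perm_cat // {IHs}; elim: t => [|y t IHt] //.
rewrite /= !E map_cat perm_cat // -map_comp.
by under eq_map => z do rewrite /= !mulrA.
Qed.

Lemma teq_opp s t : tensor_eq s t -> tensor_eq (fsum_opp s) (fsum_opp t).
Proof.
elim=> {s t} /=.
- by move=> s; apply: teq_refl.
- by move=> s t _; apply: teq_sym.
- by move=> s t u _ + _; apply: teq_trans.
- by move=> s s' t t' _ + _; rewrite /fsum_opp !map_cat; apply: teq_cat.
- by move=> s t; rewrite /fsum_opp !map_cat; apply: teq_catC.
- by move=> a a' b; rewrite /fsum_opp /= opprD; apply: teq_Dl.
- by move=> a b b'; apply: teq_Dr.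
- by move=> c a b; rewrite /fsum_opp /= -mulrN; apply: teq_Z.
- by move=> b; rewrite /fsum_opp /= oppr0; apply: teq_0.
Qed.

Lemma teq_mul1 y s t : tensor_eq s t ->
  tensor_eq [seq (x.1 * y.1, x.2 * y.2) | x <- s]
            [seq (x.1 * y.1, x.2 * y.2) | x <- t].
Proof.
elim=> {s t} /=.
- by move=> s; apply: teq_refl.
- by move=> s t _; apply: teq_sym.
- by move=> s t u _ + _; apply: teq_trans.
- by move=> s s' t t' _ + _; rewrite !map_cat; apply: teq_cat.
- by move=> s t; rewrite !map_cat; apply: teq_catC.
- by move=> a a' b; rewrite mulrDl; apply: teq_Dl.
- by move=> a b b'; rewrite mulrDl; apply: teq_Dr.
- by move=> c a b; rewrite -!mulrA; apply: teq_Z.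
- by move=> b; rewrite mul0r; apply: teq_0.
Qed.

Lemma teq_mull s s' t :
  tensor_eq s s' -> tensor_eq (fsum_mul s t) (fsum_mul s' t).
Proof.
move=> ss'; elim: t => [|y t IHt].
  by rewrite /fsum_mul !allpairs0r; apply: teq_refl.
apply: teq_trans (teq_perm (fsum_mul_cons _ _ _)) _.
apply: teq_trans (teq_cat (teq_mul1 y ss') IHt) (teq_sym _).
exact/teq_perm/fsum_mul_cons.
Qed.

Lemma teq_mulC s t : tensor_eq (fsum_mul s t) (fsum_mul t s).
Proof. exact/teq_perm/fsum_mulC. Qed.

Lemma teq_addN s : tensor_eq (fsum_opp s ++ s) [::].
Proof.
elim: s => [|[a b] s IHs]; first exact: teq_refl.
have -> : fsum_opp ((a, b) :: s) = [:: (- a, b)] ++ fsum_opp s by [].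
rewrite -catA; apply: teq_trans (teq_cat (teq_refl _) (_ : tensor_eq _ _)) _.
- by rewrite -cat1s; apply: teq_catC.
- rewrite -/([:: (a, b)] ++ s) -catA.
  apply: teq_trans (teq_cat (teq_refl _) (teq_cat (teq_refl _) _)) _.
  + exact: teq_trans (teq_catC _ _) IHs.
  rewrite cats0; apply: teq_trans (teq_sym (teq_Dl _ _ _)) _.
  by rewrite addNr; apply: teq_0.
Qed.

Definition tensor_add (x y : tensor) : tensor := \pi_tensor (repr x ++ repr y).
Definition tensor_opp (x : tensor) : tensor := \pi_tensor (fsum_opp (repr x)).
Definition tensor_mul (x y : tensor) : tensor :=
  \pi_tensor (fsum_mul (repr x) (repr y)).

Lemma teq_repr s : tensor_eq (repr (\pi_tensor s)) s.
Proof. by apply/tensorP; rewrite reprK. Qed.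

Lemma tensor_addE s t : tensor_add (\pi_tensor s) (\pi_tensor t) = \pi_tensor (s ++ t).
Proof. exact/tensorP/teq_cat/teq_repr/teq_repr. Qed.

Lemma tensor_oppE s : tensor_opp (\pi_tensor s) = \pi_tensor (fsum_opp s).
Proof. exact/tensorP/teq_opp/teq_repr. Qed.

Lemma tensor_mulE s t : tensor_mul (\pi_tensor s) (\pi_tensor t) = \pi_tensor (fsum_mul s t).
Proof.
apply/tensorP; apply: teq_trans (teq_mull _ (teq_repr _)) _.
apply: teq_trans (teq_mulC _ _) (teq_trans _ (teq_mulC _ _)).
exact/teq_mull/teq_repr.
Qed.

Lemma tensor_ind (P : tensor -> Prop) : (forall s, P (\pi_tensor s)) -> forall x, P x.
Proof. by move=> HP x; rewrite -[x]reprK. Qed.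

Lemma tensor_addA : associative tensor_add.
Proof.
elim/tensor_ind=> s; elim/tensor_ind=> t; elim/tensor_ind=> u.
by rewrite !tensor_addE catA.
Qed.

Lemma tensor_addC : commutative tensor_add.
Proof.
elim/tensor_ind=> s; elim/tensor_ind=> t; rewrite !tensor_addE.
exact/tensorP/teq_catC.
Qed.

Lemma tensor_add0 : left_id (\pi_tensor [::]) tensor_add.
Proof. by elim/tensor_ind=> s; rewrite tensor_addE. Qed.

Lemma tensor_addN : left_inverse (\pi_tensor [::]) tensor_opp tensor_add.
Proof.
elim/tensor_ind=> s; rewrite tensor_oppE tensor_addE.
exact/tensorP/teq_addN.
Qed.

HB.instance Definition _ :=
  GRing.isZmodule.Build tensor tensor_addA tensor_addC tensor_add0 tensor_addN.

Lemma tensor_mulA : associative tensor_mul.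
Proof.
elim/tensor_ind=> s; elim/tensor_ind=> t; elim/tensor_ind=> u.
rewrite !tensor_mulE; exact/tensorP/teq_perm/fsum_mulA.
Qed.

Lemma tensor_mulC : commutative tensor_mul.
Proof.
elim/tensor_ind=> s; elim/tensor_ind=> t; rewrite !tensor_mulE.
exact/tensorP/teq_mulC.
Qed.

Lemma tensor_mul1 : left_id (\pi_tensor [:: (1, 1)]) tensor_mul.
Proof.
elim/tensor_ind=> s; rewrite tensor_mulE /fsum_mul allpairs1l.
by congr \pi_tensor; elim: s => [|[a b] s /= ->] //=; rewrite !mul1r.
Qed.

Lemma tensor_mulDl : left_distributive tensor_mul +%R.
Proof.
elim/tensor_ind=> s; elim/tensor_ind=> t; elim/tensor_ind=> u.
have D v w : \pi_tensor v + \pi_tensor w = \pi_tensor (v ++ w).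
  exact: tensor_addE.
by rewrite D !tensor_mulE D fsum_mulDl.
Qed.

HB.instance Definition _ := GRing.Zmodule_isComPzRing.Build tensor
  tensor_mulA tensor_mulC tensor_mul1 tensor_mulDl.

Definition pure_tensor (a : K) (b : B) : tensor := \pi_tensor [:: (a, b)].

Lemma tensor_pureE s : \pi_tensor s = \sum_(x <- s) pure_tensor x.1 x.2.
Proof.
elim: s => [|[a b] s IHs]; first by rewrite big_nil.
by rewrite big_cons -IHs [RHS]tensor_addE.
Qed.

Definition scalar_tensor (a : K) : tensor := pure_tensor a 1.

Lemma scalar_tensor_zmod : zmod_morphism scalar_tensor.
Proof.
move=> a b; rewrite /scalar_tensor /pure_tensor.
rewrite -[RHS]/(tensor_add _ (tensor_opp _)) tensor_oppE tensor_addE.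
exact/tensorP/teq_Dl.
Qed.

Lemma scalar_tensor_monoid : monoid_morphism scalar_tensor.
Proof.
split=> // a b; rewrite -[RHS]/(tensor_mul _ _) tensor_mulE.
by rewrite /fsum_mul /= mulr1.
Qed.

HB.instance Definition _ :=
  GRing.isZmodMorphism.Build K tensor scalar_tensor scalar_tensor_zmod.
HB.instance Definition _ :=
  GRing.isMonoidMorphism.Build K tensor scalar_tensor scalar_tensor_monoid.
End Tensor.

(* Bilinear maps factor through the tensor product. *)
Lemma teq_bilinear (k K B : comNzRingType) (iota : {rmorphism k -> K})
    (phi : {rmorphism k -> B}) (V : zmodType) (h : K -> B -> V) :
    (forall a a' b, h (a + a') b = h a b + h a' b) ->
    (forall a b b', h a (b + b') = h a b + h a b') ->
    (forall c a b, h (iota c * a) b = h a (phi c * b)) ->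
  forall s t, tensor_eq iota phi s t ->
  \sum_(x <- s) h x.1 x.2 = \sum_(x <- t) h x.1 x.2.
Proof.
move=> hDl hDr hZ s t; elim=> {s t} //.
- by move=> s t u _ -> _.
- by move=> s s' t t' _ ss' _ tt'; rewrite !big_cat /= ss' tt'.
- by move=> s t; rewrite !big_cat /= addrC.
- by move=> a a' b; rewrite !big_cons !big_nil /= hDl !addr0.
- by move=> a b b'; rewrite !big_cons !big_nil /= hDr !addr0.
- by move=> c a b; rewrite !big_seq1 /= hZ.
move=> b; rewrite big_seq1 big_nil /=.
by apply: (addrI (h 0 b)); rewrite -hDl !addr0.
Qed.

(* prime_idealr B consists of the boolean predicates on B that are proper prime
   ideals; by excluded middle these are all the points of Spec B. *)
Section Spectrum.
Variable B : comNzRingType.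
Local Notation Spec := (prime_idealr B).

Definition zariski_closed_set (E : set B) : set Spec :=
  [set p | forall a, E a -> a \in (p : {pred B})].

Definition zariski_open (U : set Spec) : Prop :=
  exists E : set B, U = ~` zariski_closed_set E.

Definition has_nonempty_interior (X : set Spec) : Prop :=
  exists U : set Spec, [/\ zariski_open U, U !=set0 & U `<=` X].
End Spectrum.

(* B_p for a domain B, as the subring of Frac B of the fractions with
   denominator outside p. *)
Section Localization.
Variables (B : idomainType) (p : prime_idealr B).
Local Notation I := (p : {pred B}).

Definition loc_pred : pred {fraction B} :=
  fun x => `[< exists a s : B, s \notin I /\ x = tofrac a / tofrac s >].

Lemma loc_predP x : reflect
  (exists a s : B, s \notin I /\ x = tofrac a / tofrac s) (x \in loc_pred).
Proof. exact: asboolP. Qed.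

Lemma loc_den_neq0 s : s \notin I -> tofrac s != 0 :> {fraction B}.
Proof.
by apply: contraNneq => /eqP; rewrite tofrac_eq0 => /eqP->; apply: idealr0.
Qed.

Lemma loc_denM s t : s \notin I -> t \notin I -> s * t \notin I.
Proof. by move=> s_I t_I; rewrite prime_idealrM negb_or s_I. Qed.

Lemma loc_den1 : 1 \notin I. Proof. by rewrite idealr1. Qed.

Lemma loc_subring_closed : subring_closed loc_pred.
Proof.
split.
- apply/loc_predP; exists 1, 1.
  by rewrite loc_den1 tofrac1 divr1.
- move=> _ _ /loc_predP[a [s [sI ->]]] /loc_predP[b [t [tI ->]]].
  apply/loc_predP; exists (a * t - b * s), (s * t); rewrite loc_denM //.
  by rewrite tofracB !tofracM -mulNr addf_div ?loc_den_neq0 // mulNr.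
- move=> _ _ /loc_predP[a [s [sI ->]]] /loc_predP[b [t [tI ->]]].
  apply/loc_predP; exists (a * b), (s * t); rewrite loc_denM //.
  by rewrite !tofracM mulf_div.
Qed.

Definition localization := {x : {fraction B} | loc_pred x}.
HB.instance Definition _ := SubChoice.on localization.
HB.instance Definition _ := GRing.SubChoice_isSubComNzRing.Build
  {fraction B} loc_pred localization loc_subring_closed.

Lemma toloc_subproof (a : B) : loc_pred (tofrac a).
Proof. by apply/loc_predP; exists a, 1; rewrite loc_den1 tofrac1 divr1. Qed.

Definition toloc (a : B) : localization := Sub (tofrac a) (toloc_subproof a).

Lemma toloc_zmod : zmod_morphism toloc.
Proof. by move=> a b; apply: val_inj; rewrite rmorphB /= tofracB. Qed.

Lemma toloc_monoid : monoid_morphism toloc.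
Proof.
split=> [|a b]; apply: val_inj; first by rewrite rmorph1 /= tofrac1.
by rewrite rmorphM /= tofracM.
Qed.

HB.instance Definition _ :=
  GRing.isZmodMorphism.Build B localization toloc toloc_zmod.
HB.instance Definition _ :=
  GRing.isMonoidMorphism.Build B localization toloc toloc_monoid.

(* The ideal p B_p. *)
Definition loc_ideal : pred localization := fun x =>
  `[< exists a s : B, [/\ a \in I, s \notin I & val x = tofrac a / tofrac s] >].

Lemma loc_idealP x : reflect
  (exists a s : B, [/\ a \in I, s \notin I & val x = tofrac a / tofrac s])
  (x \in loc_ideal).
Proof. exact: asboolP. Qed.

Lemma loc_ideal_closed : idealr_closed loc_ideal.
Proof.
split.
- apply/loc_idealP; exists 0, 1.
  by rewrite loc_den1 idealr0 rmorph0 tofrac0 mul0r.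
- apply/loc_idealP => -[a [s [aI sI]]]; rewrite rmorph1 => /esym/divr1_eq.
  move/eqP; rewrite tofrac_eq => /eqP as_eq.
  by rewrite -as_eq aI in sI.
- move=> x u v /loc_idealP[a [s [aI sI ue]]] /loc_idealP[b [t [bI tI ve]]].
  have /loc_predP[c [r [rI xe]]] : val x \in loc_pred by apply: valP.
  apply/loc_idealP; exists (t * c * a + r * s * b), (r * s * t).
  split; [by rewrite rpredD ?idealMr | by rewrite !loc_denM |].
  rewrite rmorphD rmorphM /= ue ve xe mulf_div -!tofracM.
  rewrite addf_div ?loc_den_neq0 ?loc_denM // -!(tofracM, tofracD).
  by rewrite [_ * t]mulrC [t * (_ * _)]mulrA [b * _]mulrC.
Qed.

HB.instance Definition _ := isIdealr.Build localization loc_ideal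
  loc_ideal_closed.

Definition loc_max : idealr localization := loc_ideal.

Definition residue_field := {ideal_quot loc_max}.
HB.instance Definition _ := GRing.ComNzRing.on residue_field.
HB.instance Definition _ := NzRingQuotient.on residue_field.

Definition residue_inv (x : residue_field) : residue_field :=
  if x == 0 then 0 else \pi_residue_field (insubd 0 (val (repr x))^-1).

Lemma residue_mulVf x : x != 0 -> residue_inv x * x = 1.
Proof.
move=> x0; rewrite /residue_inv (negPf x0); set r := repr x.
have xE : x = \pi_residue_field r by rewrite /r reprK.
have rI : r \notin loc_ideal.
  by apply: contraNN x0 => rI; rewrite xE piE Quotient.equivE subr0.
have /loc_predP[a [s [sI re]]] : val r \in loc_pred by apply: valP.
have aI : a \notin I.
  by apply: contraNN rI => aI; apply/loc_idealP; exists a, s.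
have vI : (val r)^-1 \in loc_pred.
  by apply/loc_predP; exists s, a; rewrite re invf_div.
rewrite [X in _ * X]xE -rmorphM -[RHS](rmorph1 \pi_residue_field).
congr \pi_residue_field; apply: val_inj; rewrite rmorphM rmorph1 /=.
by rewrite insubdK // mulVf // re mulf_neq0 ?invr_eq0 ?loc_den_neq0.
Qed.

Lemma residue_inv0 : residue_inv 0 = 0.
Proof. by rewrite /residue_inv eqxx. Qed.

HB.instance Definition _ :=
  GRing.ComNzRing_isField.Build residue_field residue_mulVf residue_inv0.

Definition toresidue : B -> residue_field := \pi_residue_field \o toloc.

HB.instance Definition _ := GRing.RMorphism.on toresidue.
End Localization.

Definition finitely_generated (k B : comNzRingType) (phi : {rmorphism k -> B}) :
    Prop :=
  exists n (b : 'I_n -> B), forall x : B,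
    exists P : {mpoly k[n]}, mmap phi b P = x.

(* K/k \in PE_k(B), where K/k is given by iota and the k-algebra B by phi. *)
Definition PE (k : fieldType) (B : comNzRingType) (phi : {rmorphism k -> B})
    (K : fieldType) (iota : {rmorphism k -> K}) : Prop :=
  exists n (f : {rmorphism tensor iota phi -> {mpoly K[n]}}),
    (forall a : K, f (scalar_tensor iota phi a) = a%:MP) /\ injective f.

(* X_k(B) *)
Definition PE_points (k : fieldType) (B : idomainType)
    (phi : {rmorphism k -> B}) : set (prime_idealr B) :=
  [set p | PE phi (toresidue p \o phi)].

(* Main.v *)
Require Import Defs.
From HB Require Import structures.
From mathcomp Require Import all_boot all_order all_algebra.
From mathcomp Require Import fieldext.
From mathcomp Require Import boolp classical_sets.
From mathcomp Require Import mpoly.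

(** Write [K = Frac B] and [X = (X_1, ..., X_n)]. An embedding of
[K]-algebras from [K ⊗ B] to [K[X]] amounts to a homomorphism of [k]-algebras
[psi : B -> K[X]] that sends [k]-independent families to [K]-independent ones
([PE_indepP]). Ranks do not change under field extension, so the condition is
stable under enlarging [K] ([PE_extension]).

If the set of points contains a nonempty open set, it contains the zero ideal
of the domain [B], whose residue field is [K].

Conversely, let [psi : B -> K[X]] be as above. As [B] is finitely generated,
one nonzero [s] is a denominator for all of [psi], up to powers ([common_den]).
If [s] is not in the prime [p], then [psi] has coefficients in [B_p] and reduces
to [psi_p : B -> kappa(p)[X]] ([reduction_mod_prime]). The point is that
[kappa(p) ⊗ B -> kappa(p)[X]] stays injective for all [p] outside a proper
closed set, although infinitely many families must stay independent.

The image [R0] of [B ⊗ B] in [K[X]] is isomorphic to [B ⊗ B], and by a theorem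
of Chevalley ([adjoin_generic]) there is a nonzero [a] in [R0] such that every
homomorphism from [R0] to a field that does not kill [a] extends to [R0[X]]
after enlarging the field. Write [a] as the sum of the [a_l ⊗ b_l] with the
[b_l] independent over [k], so that some [a_l] is nonzero. The open set is the
set of the [p] that do not contain [s a_l] ([generic_PE_points]). For such a
[p], let [W] be a field that contains both [kappa(p)] and [K] over [k]
([compositum]). Since the condition on [K] passes to [W], the map
[kappa(p) ⊗ B -> W ⊗ B -> W[X]] is injective. Restricted to [R0 = B ⊗ B] it
does not kill [a], because [a_l] is not in [p]. So it extends to a homomorphism
from [R0[X]] to an extension of [W(X)], and this means that
[kappa(p) ⊗ B -> W(X)] factors, up to a field extension, through
[kappa(p) ⊗ B -> kappa(p)[X]], which must therefore be injective. *)

Set Implicit Arguments.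
Unset Strict Implicit.
Unset Printing Implicit Defensive.

Import GRing.Theory.
Local Open Scope ring_scope.
Local Open Scope quotient_scope.

(** * Homomorphisms of rings and their images *)

Lemma rmorph_lift (A C D : pzRingType) (f : {rmorphism A -> C})
    (j : {rmorphism D -> C}) :
    injective j -> (forall a, exists d, j d = f a) ->
  exists f' : {rmorphism A -> D}, forall a, j (f' a) = f a.
Proof.
move=> j_inj /choice[g jg].
have g_zmod : zmod_morphism g.
  by move=> a b; apply: j_inj; rewrite rmorphB !jg rmorphB.
have g_mon : monoid_morphism g.
  by split=> [|a b]; apply: j_inj; rewrite ?rmorph1 ?rmorphM !jg ?rmorph1 ?rmorphM.
pose m1 := GRing.isZmodMorphism.Build A D g g_zmod.
pose m2 := GRing.isMonoidMorphism.Build A D g g_mon.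
pose g' : {rmorphism A -> D} := HB.pack g m1 m2.
by exists g'.
Qed.

Lemma rmorph_factor (T R W : pzRingType) (p : {rmorphism T -> R})
    (h : {rmorphism T -> W}) :
    (forall r, exists t, p t = r) -> (forall t, p t = 0 -> h t = 0) ->
  exists h' : {rmorphism R -> W}, forall t, h' (p t) = h t.
Proof.
move=> p_surj ker; have /choice[s ps] := p_surj.
have hE t t' : p t = p t' -> h t = h t'.
  move=> e; apply/eqP; rewrite -subr_eq0 -rmorphB; apply/eqP/ker.
  by rewrite rmorphB e subrr.
have g_zmod : zmod_morphism (h \o s).
  by move=> a b; rewrite /= -rmorphB; apply: hE; rewrite rmorphB !ps.
have g_mon : monoid_morphism (h \o s).
  split=> [|a b] /=; first by rewrite -(rmorph1 h); apply: hE; rewrite rmorph1 ps.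
  by rewrite -rmorphM; apply: hE; rewrite rmorphM !ps.
pose m1 := GRing.isZmodMorphism.Build R W _ g_zmod.
pose m2 := GRing.isMonoidMorphism.Build R W _ g_mon.
pose g' : {rmorphism R -> W} := HB.pack (h \o s) m1 m2.
by exists g' => t; apply: hE; rewrite ps.
Qed.

(** The inverse in [E] of an element of the image need not lie in the image, so
the image cannot inherit its unit structure from [E]: its units are chosen by
excluded middle. *)
Section ImageDomain.
Variables (T : pzRingType) (E : idomainType) (g : {rmorphism T -> E}).

Definition image_pred : pred E := fun x => `[< exists t, g t = x >].

Lemma image_predP x : reflect (exists t, g t = x) (x \in image_pred).
Proof. exact: asboolP. Qed.

Lemma image_subring_closed : subring_closed image_pred.
Proof.
split; first by apply/image_predP; exists 1; rewrite rmorph1.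
- move=> _ _ /image_predP[s <-] /image_predP[t <-].
  by apply/image_predP; exists (s - t); rewrite rmorphB.
- move=> _ _ /image_predP[s <-] /image_predP[t <-].
  by apply/image_predP; exists (s * t); rewrite rmorphM.
Qed.

Definition image_ring := {x : E | image_pred x}.
HB.instance Definition _ := SubChoice.on image_ring.
HB.instance Definition _ := GRing.SubChoice_isSubComNzRing.Build
  E image_pred image_ring image_subring_closed.

Definition image_unit : pred image_ring := fun x => `[< exists y, y * x = 1 >].

Definition image_inv (x : image_ring) : image_ring :=
  if pselect (exists y, y * x = 1) is left ex then projT1 (cid ex) else x.

Lemma image_mulVx : {in image_unit, left_inverse 1 image_inv *%R}.
Proof.
move=> x /asboolP ex; rewrite /image_inv; case: pselect => // ex'.
by case: (cid ex').
Qed.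

Lemma image_unitPl x y : y * x = 1 -> image_unit x.
Proof. by move=> yx; apply/asboolP; exists y. Qed.

Lemma image_inv_out : {in [predC image_unit], image_inv =1 id}.
Proof.
move=> x /negP xU; rewrite /image_inv; case: pselect => // ex.
by case: xU; apply/asboolP.
Qed.

HB.instance Definition _ := GRing.ComNzRing_hasMulInverse.Build image_ring
  image_mulVx image_unitPl image_inv_out.

Lemma image_integral (x y : image_ring) : x * y = 0 -> (x == 0) || (y == 0).
Proof.
move=> xy; have : val (x * y) = 0 by rewrite xy rmorph0.
by rewrite rmorphM -!(inj_eq val_inj) !rmorph0 => /eqP; rewrite mulf_eq0.
Qed.

HB.instance Definition _ :=
  GRing.ComUnitRing_isIntegral.Build image_ring image_integral.
End ImageDomain.

(** All the subrings generated by finitely many elements below arise in this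
way, as images of polynomial rings or tensor products; a homomorphism out of
them is then obtained by [rmorph_factor]. *)
Lemma image_domain (T : pzRingType) (E : idomainType) (g : {rmorphism T -> E}) :
  exists (R : idomainType) (p : {rmorphism T -> R}) (j : {rmorphism R -> E}),
    [/\ injective j, (forall r, exists t, p t = r) & forall t, j (p t) = g t].
Proof.
have [t|p pE] := @rmorph_lift T E (image_ring g) g val val_inj.
  have gt : image_pred g (g t) by apply/image_predP; exists t.
  by exists (Sub (g t) gt).
exists (image_ring g), p, val; split=> //; first exact: val_inj.
move=> r; have /image_predP[t gt] : val r \in image_pred g by apply: valP.
by exists t; apply: val_inj; rewrite pE.
Qed.

Lemma frac_repr (A : idomainType) (x : {fraction A}) :
  exists a b : A, b != 0 /\ x = tofrac a / tofrac b.
Proof.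
elim/quotW: x => r; exists \n_r, \d_r; split=> /=; first exact: denom_ratioP.
apply: (canRL (mulfK _)); first by rewrite tofrac_eq0 denom_ratioP.
rewrite -[_ * _]/(FracField.mul _ _) !piE; apply/eqmodP.
rewrite /= FracField.equivfE /FracField.mulf.
by rewrite !numden_Ratio ?mulr1 ?mulf_neq0 ?denom_ratioP ?oner_neq0 // mulrC.
Qed.

Lemma frac_lift (A : idomainType) (F : fieldType) (h : {rmorphism A -> F}) :
    injective h ->
  exists H : {rmorphism {fraction A} -> F}, forall a, H (tofrac a) = h a.
Proof.
move=> h_inj.
have h0 a : a != 0 -> h a != 0 by rewrite raddf_eq0.
have /choice[r rP] (x : {fraction A}) :
    exists ab : A * A, ab.2 != 0 /\ x = tofrac ab.1 / tofrac ab.2.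
  by have [a [b xE]] := frac_repr x; exists (a, b).
pose g x := h (r x).1 / h (r x).2.
have gE x a b : b != 0 -> x = tofrac a / tofrac b -> g x = h a / h b.
  move=> b0 xE; have [d0 xr] := rP x; rewrite /g; apply/eqP.
  rewrite eqr_div ?h0 // -!rmorphM (inj_eq h_inj) -tofrac_eq !tofracM.
  by rewrite -eqr_div ?tofrac_eq0 // -xr xE.
have g_zmod : zmod_morphism g.
  move=> x y; have [dx xr] := rP x; have [dy yr] := rP y.
  rewrite (@gE (x - y) ((r x).1 * (r y).2 - (r y).1 * (r x).2)
    ((r x).2 * (r y).2)).
  - by rewrite rmorphB !rmorphM -mulNr -addf_div ?h0 // mulNr.
  - by rewrite mulf_neq0.
  rewrite {1}xr {1}yr tofracB !tofracM -[in RHS]mulNr.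
  by rewrite -addf_div ?tofrac_eq0 // mulNr.
have g_mon : monoid_morphism g.
  split=> [|x y].
    by rewrite (@gE 1 1 1) ?rmorph1 ?divr1 ?oner_neq0.
  have [dx xr] := rP x; have [dy yr] := rP y.
  rewrite (@gE (x * y) ((r x).1 * (r y).1) ((r x).2 * (r y).2)) ?mulf_neq0 //.
    by rewrite !rmorphM -mulf_div.
  by rewrite {1}xr {1}yr !tofracM mulf_div.
pose m1 := GRing.isZmodMorphism.Build {fraction A} F g g_zmod.
pose m2 := GRing.isMonoidMorphism.Build {fraction A} F g g_mon.
pose g' : {rmorphism {fraction A} -> F} := HB.pack g m1 m2.
exists g' => a; rewrite -[LHS]/(g _) (@gE _ a 1) ?oner_neq0 //.
  by rewrite rmorph1 divr1.
by rewrite tofrac1 divr1.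
Qed.

Lemma rmorph_mmap (A S S' : comNzRingType) n (f : {rmorphism A -> S})
    (y : 'I_n -> S) (i : {rmorphism S -> S'}) (P : {mpoly A[n]})
    (f' : {rmorphism A -> S'}) (y' : 'I_n -> S') :
    (forall a, i (f a) = f' a) -> (forall j, i (y j) = y' j) ->
  i (mmap f y P) = mmap f' y' P.
Proof.
move=> fE yE; rewrite /mmap rmorph_sum; apply: eq_bigr => m _ /=.
rewrite rmorphM fE /mmap1 rmorph_prod; congr (_ * _); apply: eq_bigr => j _ /=.
by rewrite rmorphXn yE.
Qed.

Lemma map_map_mpoly (R S T : comNzRingType) n (f : {rmorphism R -> S})
    (g : {rmorphism S -> T}) (h : {rmorphism R -> T}) :
  (forall a, g (f a) = h a) ->
  forall P : {mpoly R[n]}, map_mpoly g (map_mpoly f P) = map_mpoly h P.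
Proof.
by move=> gfE P; apply/mpolyP => m; rewrite !mcoeff_map_mpoly /= gfE.
Qed.

Lemma map_mpoly_inj (R S : comNzRingType) n (f : {rmorphism R -> S}) :
  injective f -> injective (map_mpoly f : {mpoly R[n]} -> {mpoly S[n]}).
Proof.
move=> f_inj P Q PQ; apply/mpolyP => m; apply: f_inj.
by rewrite -!mcoeff_map_mpoly PQ.
Qed.

(** * Extending homomorphisms to fields, after Chevalley *)

Lemma irreducible_factor (F : fieldType) (p : {poly F}) :
  (1 < size p)%N -> exists2 q, irreducible_poly q & q %| p.
Proof.
have [m] := ubnP (size p); elim: m p => // m IHm p; rewrite ltnS => pm p1.
have [irr|/not_andP[//|/existsNP[q]]] := pselect (irreducible_poly p).
  by exists p.
move=> /not_implyP[q1 /not_implyP[qp /negP nqp]].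
have p0 : p != 0 by rewrite -size_poly_gt0 ltnW.
have qp_lt : (size q < size p)%N.
  by rewrite ltn_neqAle (dvdp_leq p0 qp) andbT dvdp_size_eqp.
have q_gt1 : (1 < size q)%N.
  by rewrite ltn_neqAle eq_sym q1 size_poly_gt0 (dvdpN0 qp p0).
have [r irr_r rq] := IHm q (leq_trans qp_lt pm) q_gt1.
by exists r => //; apply: dvdp_trans rq qp.
Qed.

Lemma exists_root_extension (F : fieldType) (p : {poly F}) : (1 < size p)%N ->
  exists (L : fieldType) (i : {rmorphism F -> L}) (z : L), root (map_poly i p) z.
Proof.
move=> /irreducible_factor[q irr_q /dvdpP[r ->]].
have [L _ [z qz _]] := irredp_FAdjoin irr_q.
by exists L, (in_alg L), z; rewrite rmorphM rootM qz orbT.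
Qed.

(** This is the algebraic content of Chevalley's theorem on constructible
images. Asking that an arbitrary nonzero [c] survive is what makes the property
stable under composition. The last clause serves to embed [R'] in an extension
of [W] when [R] is a field. *)
Definition generic_extension (R R' : idomainType) (u : {rmorphism R -> R'}) :=
  forall c : R', c != 0 -> exists2 a : R, a != 0 &
  forall (W : fieldType) (h : {rmorphism R -> W}), h a != 0 ->
  exists (W' : fieldType) (i : {rmorphism W -> W'}) (h' : {rmorphism R' -> W'}),
    [/\ forall r, h' (u r) = i (h r), h' c != 0 & injective h -> injective h'].

(** Here [R' = R[x]], with [p] the evaluation at [x]. *)
Section Adjoin.
Variables (R R' : idomainType) (p : {rmorphism {poly R} -> R'}).
Hypothesis p_surj : forall r, exists Q, p Q = r.

(** The element [x] can be sent to the indeterminate of [W(T)]; then [c]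
survives as soon as one of its coefficients does. *)
Lemma transcendental_extension : (forall Q, p Q = 0 -> Q = 0) ->
  generic_extension (p \o polyC).
Proof.
move=> p_inj c c0; have [Q QE] := p_surj c.
have Q0 : Q != 0 by apply: contraNneq c0 => Q0; rewrite -QE Q0 rmorph0.
exists (lead_coef Q); first by rewrite lead_coef_eq0.
move=> W h ha.
pose t := @FracField.tofrac {poly W} \o map_poly h.
have [|h' h'E] := @rmorph_factor _ _ _ p t p_surj.
  by move=> S /p_inj ->; rewrite rmorph0.
exists {fraction {poly W}}, (@FracField.tofrac {poly W} \o polyC), h'; split.
- by move=> r; rewrite /= h'E /t /= map_polyC.
- rewrite -QE h'E /t /= tofrac_eq0.
  apply: contraNneq ha => /(congr1 (coefp (size Q).-1)).
  by rewrite /= coef_map coef0 => <-.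
move=> h_inj x y; have [S <-] := p_surj x; have [S' <-] := p_surj y.
rewrite !h'E /t /= => /eqP; rewrite tofrac_eq => /eqP /map_inj_poly -> //.
exact: rmorph0.
Qed.

Hypothesis const_inj : forall r, p r%:P = 0 -> r = 0.

Section Minimal.
Variable P : {poly R}.
Hypotheses (P0 : P != 0) (pP : p P = 0).
Hypothesis P_min : forall Q, Q != 0 -> p Q = 0 -> (size P <= size Q)%N.

(** The remainder of a pseudo-division by [P] is again a relation on [x], of
smaller degree than [P]. *)
Lemma minimal_pdiv Q : p Q = 0 ->
  exists m D, lead_coef P ^+ m *: Q = D * P.
Proof.
move=> pQ; have := Pdiv.Idomain.divp_eq Q P; set S := Q %% P => e.
exists (scalp Q P), (Q %/ P); rewrite e; suff -> : S = 0 by rewrite addr0.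
apply/eqP; apply: contraTT isT => S0.
have : (size S < size P)%N by rewrite ltn_modpN0.
rewrite ltnNge P_min //; move/(congr1 p): e.
by rewrite -mul_polyC rmorphD !rmorphM pQ pP !mulr0 add0r.
Qed.

(** A relation [P] of least degree is irreducible over [Frac R], hence coprime
to every [Q] that does not vanish at [x]. *)
Lemma minimal_Bezout Q : p Q != 0 ->
  exists2 r, r != 0 & exists U V, U * P + V * Q = r%:P.
Proof.
move=> pQ; have : coprimep P Q.
  have /Pdiv.Idomain.dvdpP[[c1 q1] /= c1_0 e1] := dvdp_gcdl P Q.
  have /Pdiv.Idomain.dvdpP[[c2 q2] /= c2_0 e2] := dvdp_gcdr P Q.
  set d := gcdp P Q in e1 e2; have pd : p d != 0.
    apply: contraNneq pQ => pd; move/(congr1 p)/eqP: e2.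
    rewrite -mul_polyC !rmorphM pd mulr0 mulf_eq0 => /orP[/eqP/const_inj/eqP|//].
    by rewrite (negPf c2_0).
  have pq1 : p q1 = 0.
    move/(congr1 p)/esym/eqP: e1; rewrite -mul_polyC !rmorphM pP mulr0 mulf_eq0.
    by rewrite (negPf pd) orbF => /eqP.
  have q1d : q1 * d != 0 by rewrite -e1 -mul_polyC mulf_neq0 ?polyC_eq0.
  have q10 : q1 != 0 by apply: contraNneq q1d => ->; rewrite mul0r.
  have d0 : d != 0 by apply: contraNneq q1d => ->; rewrite mulr0.
  (* A common factor [d] is no relation on [x], so its cofactor [q1] in [P] is
     one, and the minimality of [P] leaves only degree 0 for [d]. *)
  have := P_min q10 pq1; rewrite -(size_scale P c1_0) e1 size_mul //.
  rewrite /coprimep -/d; move: d0; rewrite -size_poly_gt0.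
  case: (size d) => // n _; rewrite addnS /= -[leqRHS]addn0 leq_add2l leqn0.
  by move=> /eqP->.
move=> /Bezout_coprimepP[[U V] /eqp_size]; rewrite size_poly1 => /eqP.
by case/size_poly1P=> r r0 e; exists r => //; exists U, V.
Qed.

(** Send [x] to a root of the image of [P] in an extension of [W]. This is well
defined if the leading coefficient of [P] is not killed, because [P] then
pseudo-divides all the relations; and [c] survives with the Bezout constant [r]
of [c] and [P]. *)
Lemma algebraic_extension : generic_extension (p \o polyC).
Proof.
move=> c; have [Q <-] := p_surj c => /minimal_Bezout[r r0 [U [V UV]]].
exists (lead_coef P * r); first by rewrite mulf_neq0 ?lead_coef_eq0.
move=> W h; rewrite rmorphM mulf_eq0 negb_or => /andP[hl hr].
have sP : (1 < size (map_poly h P))%N.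
  rewrite size_map_poly_id0 // ltnNge; apply/negP => /size1_polyC PE.
  by have := P0; rewrite PE (const_inj (r := P`_0)) ?polyC0 ?eqxx // -PE.
have [W' [i [z]]] := exists_root_extension sP.
rewrite -map_poly_comp => /rootP Pz.
have cz : commr_rmorph (i \o h) z by move=> y; apply: mulrC.
have [S pS|h' h'E] := @rmorph_factor _ _ _ p (horner_morph cz) p_surj.
  have [m [D /(congr1 (horner_morph cz))/eqP]] := minimal_pdiv pS.
  rewrite -mul_polyC !rmorphM [X in _ == _ * X]Pz mulr0 mulf_eq0.
  rewrite /= horner_morphC /= !rmorphXn expf_eq0 fmorph_eq0 (negPf hl) andbF.
  by move=> /eqP.
have nz S s : (exists U V, U * P + V * S = s%:P) -> h s != 0 -> h' (p S) != 0.
  move=> [X [Y XY]]; rewrite h'E -(fmorph_eq0 i) => hs.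
  apply: contraNneq hs => hS; have := congr1 (horner_morph cz) XY.
  rewrite rmorphD !rmorphM hS [X in _ * X + _]Pz !mulr0 addr0.
  by rewrite horner_morphC /= => <-.
exists W', i, h'; split.
- by move=> s; rewrite /= h'E /= horner_morphC.
- by apply: nz hr; exists U, V.
move=> h_inj; apply/raddf_inj => x; have [S <-] := p_surj x => pS.
apply/eqP; apply: contraTT isT => /minimal_Bezout[s s0 es].
have : h' (p S) != 0 by apply: nz es _; rewrite -(rmorph0 h) (inj_eq h_inj).
by rewrite pS eqxx.
Qed.
End Minimal.

Lemma simple_extension : generic_extension (p \o polyC).
Proof.
have [p_inj|] := pselect (forall Q, p Q = 0 -> Q = 0).
  exact: transcendental_extension.
move=> /existsNP[Q0 /not_implyP[pQ0 /eqP nQ0]].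
have exP : exists n, `[< exists Q, [/\ Q != 0, p Q = 0 & size Q = n] >].
  by exists (size Q0); apply/asboolP; exists Q0.
case: (ex_minnP exP) => n /asboolP[P [P0 pP <-]] P_min.
apply: algebraic_extension P0 pP _ => Q Qn pQ.
by apply: P_min; apply/asboolP; exists Q.
Qed.
End Adjoin.

Lemma generic_extension_comp (R R1 R2 : idomainType) (u : {rmorphism R -> R1})
    (v : {rmorphism R1 -> R2}) :
  generic_extension u -> generic_extension v -> generic_extension (v \o u).
Proof.
move=> gu gv c /gv[b b0 hb]; have [a a0 ha] := gu b b0; exists a => // W h /ha.
move=> [W1 [i [h1 [h1E /hb]]]] [W2 [i2 [h2 [h2E h2c h2i]]]] h1i.
exists W2, (i2 \o i), h2; split=> //= [r|h_inj]; first by rewrite h2E h1E.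
exact/h2i/h1i.
Qed.

Lemma adjoin_generic (E : idomainType) (xs : seq E) (R : idomainType)
    (j : {rmorphism R -> E}) : injective j ->
  exists (R' : idomainType) (u : {rmorphism R -> R'}) (j' : {rmorphism R' -> E}),
    [/\ injective j', forall r, j' (u r) = j r,
        {in xs, forall x, exists y, j' y = x} & generic_extension u].
Proof.
elim: xs R j => [|x xs IHxs] R j j_inj.
  exists R, idfun, j; split=> // c c0; exists c => // W h hc.
  by exists W, idfun, h; split.
have cx : commr_rmorph j x by move=> y; apply: mulrC.
have [R1 [p [j1 [j1_inj p_surj pE]]]] := image_domain (horner_morph cx).
have j1E r : j1 (p r%:P) = j r by rewrite pE /= horner_morphC.
have [R2 [v [j2 [j2_inj j2E xs_im gv]]]] := IHxs R1 j1 j1_inj.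
exists R2, (v \o (p \o polyC)), j2; split=> //.
- by move=> r; rewrite /= j2E j1E.
- move=> y; rewrite inE => /predU1P[->|/xs_im//].
  by exists (v (p 'X)); rewrite j2E pE /= horner_morphX.
apply: generic_extension_comp gv; apply: simple_extension => // r pr.
by apply: j_inj; rewrite rmorph0 -j1E pr rmorph0.
Qed.

(** * Linear independence and the tensor product *)

Definition lin_indep (k A : pzRingType) (phi : {rmorphism k -> A}) m
    (b : 'I_m -> A) :=
  forall c : 'I_m -> k, \sum_i phi (c i) * b i = 0 -> forall i, c i = 0.

Section DualFunctional.
Local Open Scope classical_set_scope.
Variables (k : fieldType) (B : comNzRingType) (phi : {rmorphism k -> B}).

Definition subspace (M : set B) :=
  forall c u v, M u -> M v -> M (phi c * u + v).

Lemma subspace_bigcup (F : set (set B)) (N : set B) :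
    subspace N -> (forall X, F X -> subspace (X `|` N)) -> total_on F subset ->
  subspace (\bigcup_(X in F) X `|` N).
Proof.
move=> sN sF totF c u v.
have inF X w : F X -> (X `|` N) w -> (\bigcup_(X in F) X `|` N) w.
  by move=> FX [Xw|]; [left; exists X|right].
move=> [[X FX Xu]|Nu] [[Y FY Yv]|Nv].
- case: (totF X Y FX FY) => [XY|YX].
  + by apply: (inF Y) => //; apply: sF => //; left => //; apply: XY.
  + by apply: (inF X) => //; apply: sF => //; left => //; apply: YX.
- by apply: (inF X) => //; apply: sF => //; [left|right].
- by apply: (inF Y) => //; apply: sF => //; [right|left].
- by right; apply: sN.
Qed.

(** A subspace that contains [N] and is maximal among those that avoid [e] is a
hyperplane complementary to the line of [e]. Zorn's lemma is applied to the
sets [X] for which [X `|` N] is such a subspace, so that the union of the empty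
chain causes no exception. *)
Lemma separating_functional (N : set B) (e : B) :
    subspace N -> N 0 -> ~ N e ->
  exists l : B -> k, [/\ {morph l : u v / u + v},
    forall c v, l (phi c * v) = c * l v, l e = 1 & forall v, N v -> l v = 0].
Proof.
move=> sN N0 Ne.
have [|A [[sM Me] maxA]] :=
    @Zorn_bigcup B (fun X => subspace (X `|` N) /\ ~ (X `|` N) e).
  move=> F FP totF; split.
    by apply: subspace_bigcup => // X /FP[].
  by move=> [[X FX Xe]|//]; have [_ []] := FP X FX; left.
pose M := A `|` N; have M0 : M 0 by right.
have MZ c u : M u -> M (phi c * u) by move=> Mu; rewrite -[_ * _]addr0; apply: sM.
have MD u v : M u -> M v -> M (u + v).
  by move=> Mu Mv; rewrite -[u]mul1r -(rmorph1 phi); apply: sM.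
have MB u v : M u -> M v -> M (u - v).
  by move=> Mu Mv; rewrite addrC -mulN1r -(rmorphN1 phi); apply: sM.
have phiV c u : c != 0 -> phi c^-1 * (phi c * u) = u.
  by move=> c0; rewrite mulrA -rmorphM mulVf // rmorph1 mul1r.
have ex v : exists c, M (v - phi c * e).
  have [Mv|nMv] := pselect (M v); first by exists 0; rewrite rmorph0 mul0r subr0.
  pose A' := [set w | exists c n, M n /\ w = phi c * v + n].
  have MA' n : M n -> A' n by exists 0, n; rewrite rmorph0 mul0r add0r.
  have A'v : A' v by exists 1, 0; rewrite rmorph1 mul1r addr0.
  have A'N : A' `|` N = A'.
    by apply/seteqP; split=> [w [//|Nw]|w]; [apply: MA'; right|left].
  have sA' : subspace A'.
    move=> c _ _ [c1 [n1 [M1 ->]]] [c2 [n2 [M2 ->]]].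
    exists (c * c1 + c2), (phi c * n1 + n2); split; first exact: sM.
    by rewrite rmorphD rmorphM mulrDl mulrDr !mulrA addrACA.
  have ltA : A `<` A'.
    by split=> [w Aw|/(_ _ A'v) Av]; [apply: MA'; left|apply: nMv; left].
  have A'e : A' e.
    by apply: contrapT => nA'e; apply: maxA ltA _; rewrite A'N.
  have [c [n [Mn eE]]] := A'e.
  have c0 : c != 0.
    by apply: contra_notN Me => /eqP c0; rewrite eE c0 rmorph0 mul0r add0r.
  exists c^-1; rewrite eE mulrDr phiV // opprD addNKr -mulrN.
  by apply: MZ; rewrite -sub0r; apply: MB.
have /choice[l lP] := ex.
have lE v c : M (v - phi c * e) -> l v = c.
  move=> Mc; apply/eqP; rewrite -subr_eq0; apply: contra_notT Me => d0.
  rewrite -[e](phiV (l v - c)) //; apply: MZ.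
  have -> : phi (l v - c) * e = (v - phi c * e) - (v - phi (l v) * e).
    by rewrite rmorphB mulrBl opprB [RHS]addrC subrKA.
  exact: MB.
exists l; split.
- move=> u v; apply: lE; rewrite rmorphD mulrDl opprD addrACA; exact: MD.
- by move=> c v; apply: lE; rewrite rmorphM -mulrA -mulrBr; apply: MZ.
- by apply: lE; rewrite rmorph1 mul1r subrr.
- by move=> v Nv; apply: lE; rewrite rmorph0 mul0r subr0; right.
Qed.

Lemma dual_functional m (b : 'I_m -> B) (i0 : 'I_m) : lin_indep phi b ->
  exists l : B -> k, [/\ {morph l : u v / u + v},
    forall c v, l (phi c * v) = c * l v & forall i, l (b i) = (i == i0)%:R].
Proof.
move=> b_ind.
pose N := [set v | exists2 c : 'I_m -> k, c i0 = 0 & v = \sum_i phi (c i) * b i].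
have [||[c c0 e]|l [lD lZ le lN]] := @separating_functional N (b i0).
- move=> c _ _ [c1 z1 ->] [c2 z2 ->]; exists (fun i => c * c1 i + c2 i).
    by rewrite z1 z2 mulr0 addr0.
  rewrite mulr_sumr -big_split; apply: eq_bigr => i _ /=.
  by rewrite rmorphD rmorphM mulrDl mulrA.
- exists (fun=> 0) => //.
  by rewrite big1 // => i _; rewrite rmorph0 mul0r.
- have /b_ind/(_ i0)/eqP : \sum_i phi (c i - (i == i0)%:R) * b i = 0.
    under eq_bigr => i _ do rewrite rmorphB mulrBl.
    rewrite sumrB -e (bigD1 i0) //= eqxx rmorph1 mul1r big1 ?addr0 ?subrr //.
    by move=> i /negPf->; rewrite rmorph0 mul0r.
  by rewrite c0 eqxx sub0r oppr_eq0 oner_eq0.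
exists l; split=> // i; have [->//|ni] := eqVneq; apply: lN.
exists (fun j => (j == i)%:R); first by rewrite eq_sym (negPf ni).
rewrite (bigD1 i) //= eqxx rmorph1 mul1r big1 ?addr0 // => j /negPf->.
by rewrite rmorph0 mul0r.
Qed.
End DualFunctional.

Section TensorTheory.
Variables (k : fieldType) (K B : comNzRingType).
Variables (iota : {rmorphism k -> K}) (phi : {rmorphism k -> B}).
Local Notation "a ⊗ b" := (pure_tensor iota phi a b) (at level 40).

Lemma pure_tensorDl a a' b : (a + a') ⊗ b = a ⊗ b + a' ⊗ b.
Proof.
rewrite -[RHS]/(tensor_add _ _) tensor_addE; exact/tensorP/teq_Dl.
Qed.

Lemma pure_tensorDr a b b' : a ⊗ (b + b') = a ⊗ b + a ⊗ b'.
Proof.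
rewrite -[RHS]/(tensor_add _ _) tensor_addE; exact/tensorP/teq_Dr.
Qed.

Lemma pure_tensorZ c a b : (iota c * a) ⊗ b = a ⊗ (phi c * b).
Proof. exact/tensorP/teq_Z. Qed.

Lemma pure_tensorM a b a' b' : (a ⊗ b) * (a' ⊗ b') = (a * a') ⊗ (b * b').
Proof. by rewrite -[LHS]/(tensor_mul _ _) tensor_mulE. Qed.

Lemma pure_tensor0l b : 0 ⊗ b = 0.
Proof. exact/tensorP/teq_0. Qed.

Lemma pure_tensor0r a : a ⊗ 0 = 0.
Proof. by apply: (addrI (a ⊗ 0)); rewrite -pure_tensorDr !addr0. Qed.

Lemma pure_tensor_sumr a I (r : seq I) (P : pred I) (F : I -> B) :
  a ⊗ (\sum_(i <- r | P i) F i) = \sum_(i <- r | P i) a ⊗ F i.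
Proof. exact: (big_morph _ (pure_tensorDr a) (pure_tensor0r a)). Qed.

(** The functional dual to [b i0] induces a map from the tensor product to [K]
that reads off [a i0]. *)
Lemma pure_tensor_indep m (a : 'I_m -> K) (b : 'I_m -> B) :
  lin_indep phi b -> \sum_i a i ⊗ b i = 0 -> forall i, a i = 0.
Proof.
move=> b_ind ab0 i0; have [l [lD lZ lb]] := dual_functional i0 b_ind.
have e : tensor_eq iota phi [seq (a i, b i) | i <- enum 'I_m] [::].
  apply/tensorP; rewrite !tensor_pureE big_nil big_map big_enum /=; exact: ab0.
pose h x v : K := x * iota (l v).
have hDl x x' v : h (x + x') v = h x v + h x' v by rewrite /h mulrDl.
have hDr x v v' : h x (v + v') = h x v + h x v' by rewrite /h lD rmorphD mulrDr.
have hZ c x v : h (iota c * x) v = h x (phi c * v).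
  by rewrite /h lZ rmorphM mulrCA mulrA.
have := teq_bilinear hDl hDr hZ e.
rewrite big_map big_nil big_enum /= (bigD1 i0) //= {1}/h lb eqxx rmorph1 mulr1.
by rewrite big1 ?addr0 // => i /negPf ni; rewrite /h lb ni rmorph0 mulr0.
Qed.

(** A representation with fewest terms is independent: a relation among the
second factors expresses one of them by the others and saves a term. *)
Lemma tensor_indep_rep (x : tensor iota phi) : exists m (a : 'I_m -> K)
  (b : 'I_m -> B), lin_indep phi b /\ x = \sum_i a i ⊗ b i.
Proof.
have [m [a [b ->]]] : exists m (a : 'I_m -> K) (b : 'I_m -> B),
    x = \sum_i a i ⊗ b i.
  elim/tensor_ind: x => s; rewrite tensor_pureE.
  exists (size s), (fun i => (nth (0, 0) s i).1), (fun i => (nth (0, 0) s i).2).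
  by rewrite (big_nth (0, 0)) big_mkord.
elim: m a b => [|m IHm] a b; first by exists 0, a, b; split=> // c _ [].
have [b_ind|/existsNP[c /not_implyP[cb /existsNP[i0 /eqP ci0]]]] :=
  pselect (lin_indep phi b); first by exists m.+1, a, b.
pose d j := - (c (lift i0 j) / c i0).
have bE : b i0 = \sum_j phi (d j) * b (lift i0 j).
  have /(congr1 (fun v => phi (c i0)^-1 * v)) := cb.
  rewrite mulr0 (bigD1_ord i0) //= mulrDr mulrA -rmorphM mulVf // rmorph1 mul1r.
  move/eqP; rewrite addr_eq0 mulr_sumr -sumrN => /eqP->.
  apply: eq_bigr => j _; rewrite /d rmorphN mulNr; congr (- _).
  by rewrite mulrA -rmorphM mulrC [_^-1 * _]mulrC mulrC.
have [m' [a' [b' [b'_ind e]]]] :=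
  IHm (fun j => a (lift i0 j) + iota (d j) * a i0) (fun j => b (lift i0 j)).
exists m', a', b'; split=> //; rewrite -e (bigD1_ord i0) //= bE pure_tensor_sumr.
rewrite -big_split; apply: eq_bigr => j _ /=.
by rewrite pure_tensorDl pure_tensorZ addrC.
Qed.

Lemma tensor_lift (S : comPzRingType) (al : {rmorphism K -> S})
    (be : {rmorphism B -> S}) : (forall c, al (iota c) = be (phi c)) ->
  exists h : {rmorphism tensor iota phi -> S},
    forall a b, h (a ⊗ b) = al a * be b.
Proof.
move=> albe; pose hs (s : seq (K * B)) := \sum_(x <- s) al x.1 * be x.2.
pose g (x : tensor iota phi) := hs (repr x).
have gE s : g (\pi_(tensor iota phi) s) = hs s.
  apply: (@teq_bilinear _ _ _ _ _ S (fun a b => al a * be b)) (teq_repr iota phi s).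
  - by move=> a a' b; rewrite rmorphD mulrDl.
  - by move=> a b b'; rewrite rmorphD mulrDr.
  - by move=> c a b; rewrite !rmorphM albe mulrCA mulrA.
have gD : {morph g : x y / x + y}.
  move=> x y; elim/tensor_ind: x => s; elim/tensor_ind: y => t.
  by rewrite -[_ + _]/(tensor_add _ _) tensor_addE !gE /hs big_cat.
have g0 : g 0 = 0 by rewrite -[0]/(\pi_(tensor iota phi) [::]) gE /hs big_nil.
have g_zmod : zmod_morphism g.
  move=> x y; apply: (addIr (g y)); rewrite -gD subrK.
  by rewrite -addrA addNr addr0.
have g_mon : monoid_morphism g.
  split=> [|x y].
    rewrite -[1]/(\pi_(tensor iota phi) [:: (1, 1)]) gE /hs big_seq1.
    by rewrite !rmorph1 mulr1.
  elim/tensor_ind: x => s; elim/tensor_ind: y => t.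
  rewrite -[_ * _]/(tensor_mul _ _) tensor_mulE !gE /hs /fsum_mul.
  rewrite big_allpairs_dep mulr_suml; apply: eq_bigr => x _.
  rewrite mulr_sumr; apply: eq_bigr => y _ /=.
  by rewrite !rmorphM mulrACA.
pose m1 := GRing.isZmodMorphism.Build (tensor iota phi) S g g_zmod.
pose m2 := GRing.isMonoidMorphism.Build (tensor iota phi) S g g_mon.
pose g' : {rmorphism tensor iota phi -> S} := HB.pack g m1 m2.
by exists g' => a b; rewrite -[LHS]/(g _) gE /hs big_seq1.
Qed.

Lemma inr_tensor : exists h : {rmorphism B -> tensor iota phi},
  forall b, h b = 1 ⊗ b.
Proof.
have g_zmod : zmod_morphism (fun b => 1 ⊗ b).
  move=> u v; apply: (addIr (1 ⊗ v)); rewrite -pure_tensorDr subrK.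
  by rewrite -addrA addNr addr0.
have g_mon : monoid_morphism (fun b => 1 ⊗ b).
  by split=> // u v; rewrite pure_tensorM mulr1.
pose m1 := GRing.isZmodMorphism.Build B (tensor iota phi) _ g_zmod.
pose m2 := GRing.isMonoidMorphism.Build B (tensor iota phi) _ g_mon.
pose g' : {rmorphism B -> tensor iota phi} := HB.pack (fun b => 1 ⊗ b) m1 m2.
by exists g'.
Qed.
End TensorTheory.

(** * Embeddings into polynomial rings and independent families *)

Definition indep_preserving (k B L R : pzRingType) (phi : {rmorphism k -> B})
    (eta : {rmorphism L -> R}) (psi : B -> R) :=
  forall m (b : 'I_m -> B), lin_indep phi b -> lin_indep eta (psi \o b).

(** By [tensor_indep_rep] every tensor is a combination of independent elements
of [B], with coefficients that vanish together with it; so injectivity on the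
tensor product is a statement about independent families. *)
Lemma PE_indepP (k K : fieldType) (B : comNzRingType) (phi : {rmorphism k -> B})
    (iota : {rmorphism k -> K}) :
  PE phi iota <-> exists n (psi : {rmorphism B -> {mpoly K[n]}}),
    (forall c, psi (phi c) = (iota c)%:MP) /\
    indep_preserving phi (@mpolyC n K) psi.
Proof.
split=> [[n [f [fC f_inj]]]|[n [psi [psiC psi_ind]]]].
  have [inr inrE] := inr_tensor iota phi.
  have pureE a b : pure_tensor iota phi a b = scalar_tensor iota phi a * inr b.
    by rewrite inrE /scalar_tensor pure_tensorM mulr1 mul1r.
  exists n, (f \o inr); split=> [c|m b b_ind c cb0].
    rewrite -fC /= inrE; congr (f _).
    by rewrite -[phi c]mulr1 -pure_tensorZ mulr1.
  apply: (pure_tensor_indep (iota := iota) b_ind); apply: f_inj.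
  rewrite rmorph0 -[RHS]cb0 rmorph_sum; apply: eq_bigr => i _.
  by rewrite pureE rmorphM fC.
have [f fE] := tensor_lift (fun c => esym (psiC c)).
exists n, f; split=> [a|]; first by rewrite fE rmorph1 mulr1.
apply/raddf_inj => x; have [m [a [b [b_ind ->]]]] := tensor_indep_rep x.
rewrite raddf_sum /=; under eq_bigr => i _ do rewrite fE.
move=> /(psi_ind _ _ b_ind) a0; rewrite big1 // => i _.
by rewrite a0 pure_tensor0l.
Qed.

(** Independence of finitely many polynomials is the maximality of the rank of
the matrix of their coefficients, and the rank is insensitive to field
extension. *)
Lemma mpoly_lin_indep_map (K L : fieldType) (g : {rmorphism K -> L}) n m
    (q : 'I_m -> {mpoly K[n]}) :
  lin_indep (@mpolyC n K) q -> lin_indep (@mpolyC n L) (map_mpoly g \o q).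
Proof.
move=> q_ind.
pose d := (\max_i msize (q i))%N.
pose M := \matrix_(i < m, j < #|{: 'X_{1..n < d}}|)
  (q i)@_(enum_val j : 'X_{1..n < d}).
have sumE (F : fieldType) (c : 'I_m -> F) (r : 'I_m -> {mpoly F[n]}) mm :
    (\sum_i (c i)%:MP * r i)@_mm = \sum_i c i * (r i)@_mm.
  by rewrite raddf_sum; apply: eq_bigr => i _; rewrite /= mcoeffCM.
have M_free : row_free M.
  apply: inj_row_free => v vM0; apply/rowP => i; rewrite mxE.
  apply: (q_ind (fun i => v 0 i)); apply/mpolyP => mm; rewrite sumE mcoeff0.
  have [mm_d|mm_d] := ltnP (mdeg mm) d.
    have /rowP/(_ (enum_rank (BMultinom mm_d))) := vM0; rewrite !mxE; apply: etrans.
    by apply: eq_bigr => j _; rewrite mxE enum_rankK.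
  rewrite big1 // => j _; rewrite [_@__]memN_msupp_eq0 ?mulr0 //.
  apply: contraTN mm_d => /msize_mdeg_lt; rewrite -ltnNge => /leq_trans; apply.
  by rewrite /d (leq_bigmax j).
move=> c c0 i.
suff /rowP/(_ i) : \row_i c i = 0 by rewrite !mxE.
apply/eqP; rewrite -(mulmx_free_eq0 _ (_ : row_free (map_mx g M))) ?row_free_map //.
apply/eqP/rowP => j; rewrite !mxE.
move/(congr1 (mcoeff (enum_val j : 'X_{1..n < d}))): c0.
rewrite sumE mcoeff0; apply: etrans.
by apply: eq_bigr => l _; rewrite !mxE /= mcoeff_map_mpoly.
Qed.

Lemma PE_extension (k K L : fieldType) (B : comNzRingType)
    (phi : {rmorphism k -> B}) (iota : {rmorphism k -> K})
    (iota' : {rmorphism k -> L}) (g : {rmorphism K -> L}) :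
  (forall c, iota' c = g (iota c)) -> PE phi iota -> PE phi iota'.
Proof.
move=> gE /PE_indepP[n [psi [psiC psi_ind]]]; apply/PE_indepP.
exists n, (map_mpoly g \o psi); split=> [c|m b /psi_ind].
  by rewrite /= psiC map_mpolyC gE.
exact: mpoly_lin_indep_map.
Qed.

(** * Compositum and common denominators *)

(** [B] is obtained from [k] by adjoining finitely many elements, so the map
[k -> F], being injective, extends to an injective map from [B] to an extension
of [F]. *)
Lemma compositum (k : fieldType) (B : idomainType) (phi : {rmorphism k -> B})
    (F : fieldType) (iota : {rmorphism k -> F}) : finitely_generated phi ->
  exists (W : fieldType) (e : {rmorphism F -> W})
    (g : {rmorphism {fraction B} -> W}),
  forall c, e (iota c) = g (tofrac (phi c)).
Proof.
move=> [n [b b_gen]].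
have [R' [u [j [j_inj jE b_im gu]]]] :=
  adjoin_generic [seq b i | i <- enum 'I_n] (fmorph_inj phi).
have /choice[y yE] i : exists y, j y = b i.
  by apply: b_im; rewrite map_f ?mem_enum.
have [x|s sE] := @rmorph_lift B B R' idfun j j_inj.
  by have [P <-] := b_gen x; exists (mmap u y P); apply: rmorph_mmap.
have [a a0 ext] := gu 1 (oner_neq0 _).
have ia0 : iota a != 0 by rewrite fmorph_eq0.
have [W [e [h [hE _ h_inj]]]] := ext F iota ia0.
have [|g gE] := @frac_lift B W (h \o s).
  by move=> x x' /(h_inj (fmorph_inj iota)) e'; rewrite -[x]sE -[x']sE e'.
exists W, e, g => c; rewrite gE /= -hE; congr (h _); apply: j_inj.
by rewrite jE sE.
Qed.

Lemma mpoly_common_den (A : idomainType) n (q : {mpoly {fraction A}[n]}) :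
  exists s (G : {mpoly A[n]}), s != 0 /\
    tofrac s *: q = map_mpoly (@FracField.tofrac A) G.
Proof.
elim/mpolyind: q => [|c m q _ _ [s [G [s0 qE]]]].
  by exists 1, 0; rewrite oner_neq0 scaler0 raddf0.
have [a [t [t0 ->]]] := frac_repr c.
exists (t * s), ((s * a) *: 'X_[m] + t *: G); split; first by rewrite mulf_neq0.
rewrite [RHS]raddfD /= !map_mpolyZ map_mpolyX -qE scalerDr !scalerA !tofracM.
congr (_ *: _ + _); rewrite /= tofracM [tofrac t * _]mulrC -mulrA; congr (_ * _).
by rewrite mulrC divfK ?tofrac_eq0.
Qed.

(** Let [S] be the product of denominators of the images of the generators. The
elements of [B] whose image has a power of [S] as a denominator form a subring,
and it contains [k] and the generators. *)
Lemma common_den (k : fieldType) (B : idomainType) (phi : {rmorphism k -> B}) n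
    (psi : {rmorphism B -> {mpoly {fraction B}[n]}}) :
    finitely_generated phi -> (forall c, psi (phi c) = (tofrac (phi c))%:MP) ->
  exists2 s, s != 0 & forall b, exists N (G : {mpoly B[n]}),
    tofrac s ^+ N *: psi b = map_mpoly (@FracField.tofrac B) G.
Proof.
move=> [q [b b_gen]] psiC.
have /choice[s /choice[G sG]] i := mpoly_common_den (psi (b i)).
pose S := \prod_i s i; exists S.
  by apply/prodf_neq0 => i _; have [] := sG i.
pose C x := exists N (G : {mpoly B[n]}),
  tofrac S ^+ N *: psi x = map_mpoly (@FracField.tofrac B) G.
have CD x y : C x -> C y -> C (x + y).
  move=> [N [P PE]] [M [Q QE]]; exists (N + M)%N, (S ^+ M *: P + S ^+ N *: Q).
  rewrite rmorphD [RHS]raddfD /= !map_mpolyZ -PE -QE /= !tofracXn !scalerA -!exprD.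
  by rewrite scalerDr [(M + N)%N]addnC.
have CM x y : C x -> C y -> C (x * y).
  move=> [N [P PE]] [M [Q QE]]; exists (N + M)%N, (P * Q).
  by rewrite !rmorphM /= -PE -QE exprD -scalerAl -scalerAr scalerA.
have C0 : C 0 by exists 0%N, 0; rewrite !rmorph0 scaler0.
have C1 : C 1 by exists 0%N, 1; rewrite !rmorph1 expr0 scale1r.
have Cb i : C (b i).
  exists 1%N, ((\prod_(j | j != i) s j) *: G i).
  rewrite map_mpolyZ -(sG i).2 scalerA -tofracM expr1 /S (bigD1 i) //=.
  by rewrite mulrC.
move=> x; have [P <-] := b_gen x; rewrite -/(C _) /mmap.
apply: (big_ind C C0 CD) => m _; apply: (CM _ _).
  by exists 0%N, (phi P@_m)%:MP; rewrite psiC expr0 scale1r map_mpolyC.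
apply: (big_ind C C1 CM) => i _; elim: (m i) => [|l IHl]; first by rewrite expr0.
by rewrite exprS; apply: CM.
Qed.

(** * The generic point and residue fields *)

Section ZeroIdeal.
Variable B : idomainType.
Definition zero_ideal : pred B := fun x => x == 0.

Lemma zero_ideal_closed : idealr_closed zero_ideal.
Proof.
split=> [||a u v]; first exact: eqxx.
- by change (1 != 0 :> B); rewrite oner_neq0.
by move=> /eqP-> /eqP->; apply/eqP; rewrite mulr0 addr0.
Qed.

Lemma zero_ideal_prime : prime_idealr_closed zero_ideal.
Proof. by move=> u v /eqP/eqP; rewrite mulf_eq0. Qed.

HB.instance Definition _ := isIdealr.Build B zero_ideal zero_ideal_closed.
HB.instance Definition _ := isPrimeIdealrClosed.Build B zero_ideal zero_ideal_prime.

Definition generic_point : prime_idealr B := zero_ideal.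
End ZeroIdeal.

Lemma pi_residue_eq0 (B : idomainType) (p : prime_idealr B)
    (x : localization p) :
  (\pi_(residue_field p) x == 0) = (x \in loc_ideal (p := p)).
Proof.
by rewrite -[0](rmorph0 \pi_(residue_field p)) piE Quotient.equivE subr0.
Qed.

Lemma toresidue_eq0 (B : idomainType) (p : prime_idealr B) (x : B) :
  (toresidue p x == 0) = (x \in (p : pred B)).
Proof.
rewrite /toresidue /= pi_residue_eq0; apply/loc_idealP/idP => [[a [s [ap sp]]]|xp].
  move=> /eqP; rewrite /= -[tofrac x]divr1 -tofrac1.
  rewrite eqr_div ?(loc_den_neq0 sp) ?tofrac_eq0 ?oner_eq0 //.
  rewrite -!tofracM tofrac_eq mulr1 => /eqP xs.
  by move: ap; rewrite -xs prime_idealrM (negPf sp) orbF.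
by exists x, 1; rewrite loc_den1 tofrac1 divr1.
Qed.

(** At the zero ideal, [p B_p] is zero, so the inclusion of [B_p] in [Frac B]
factors through the residue field. *)
Lemma generic_residue (B : idomainType) :
  exists g : {rmorphism residue_field (generic_point B) -> {fraction B}},
    forall x, g (toresidue _ x) = tofrac x.
Proof.
set p := generic_point B.
have [r|t /eqP|g gE] := @rmorph_factor (localization p) (residue_field p) _
  \pi_(residue_field p) val.
- by exists (repr r); exact: reprK.
- rewrite pi_residue_eq0 => /loc_idealP[a [s [/eqP-> _ te]]].
  by rewrite [LHS]te tofrac0 mul0r.
by exists g => x; rewrite /toresidue /= gE.
Qed.

Lemma open_generic_point (B : idomainType) (U : set (prime_idealr B)) :
  zariski_open U -> (U !=set0)%classic -> U (generic_point B).
Proof.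
move=> [E ->] [p /existsNP[a /not_implyP[Ea ap]]]; apply/existsNP; exists a.
apply/not_implyP; split=> // /eqP a0.
by apply: ap; rewrite a0 idealr0.
Qed.

(** * Reduction modulo a general prime *)

Section Reduction.
Variables (B : idomainType) (p : prime_idealr B) (n : nat).
Variables (psi : {rmorphism B -> {mpoly {fraction B}[n]}}) (s : B).
Hypothesis sp : s \notin (p : pred B).
Hypothesis psi_den : forall b, exists N (G : {mpoly B[n]}),
    tofrac s ^+ N *: psi b = map_mpoly (@FracField.tofrac B) G.

(** The reduction is given by the composite [B -> B_p[X] -> kappa(p)[X]]. The
formula with denominators determines it. *)
Lemma reduction_mod_prime :
  exists psip : {rmorphism B -> {mpoly (residue_field p)[n]}},
  forall b N (G : {mpoly B[n]}),
    tofrac s ^+ N *: psi b = map_mpoly (@FracField.tofrac B) G ->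
    toresidue p s ^+ N *: psip b = map_mpoly (toresidue p) G.
Proof.
pose vl : {rmorphism localization p -> {fraction B}} := val.
have vl_inj : injective vl by exact: val_inj.
have vlE (G : {mpoly B[n]}) :
    map_mpoly vl (map_mpoly (toloc p) G) = map_mpoly (@FracField.tofrac B) G.
  exact: map_map_mpoly.
have [b|psi' psi'E] := @rmorph_lift _ _ {mpoly (localization p)[n]} psi
    (map_mpoly vl) (map_mpoly_inj vl_inj).
  have [N [G bG]] := psi_den b.
  have s0 : tofrac s != 0 :> {fraction B} by apply: loc_den_neq0 sp.
  have wP : loc_pred p (tofrac s ^+ N)^-1.
    apply/loc_predP; exists 1, (s ^+ N); rewrite tofrac1 div1r tofracXn; split=> //.
    by elim: N {bG} => [|N IHN]; rewrite ?expr0 ?loc_den1 // exprS loc_denM.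
  pose w : localization p := Sub _ wP.
  exists (w *: map_mpoly (toloc p) G); apply: etrans (map_mpolyZ vl w _) _.
  by rewrite vlE -bG scalerA [vl w]/= mulVf ?scale1r // expf_neq0.
exists (map_mpoly \pi_(residue_field p) \o psi') => b N G bG.
have -> : map_mpoly (toresidue p) G =
    map_mpoly \pi_(residue_field p) (map_mpoly (toloc p) G).
  by rewrite (@map_map_mpoly _ _ _ _ _ _ (toresidue p)).
have <- : toloc p s ^+ N *: psi' b = map_mpoly (toloc p) G.
  apply: (map_mpoly_inj vl_inj); rewrite vlE -bG -psi'E.
  by rewrite map_mpolyZ rmorphXn.
by rewrite map_mpolyZ rmorphXn.
Qed.
End Reduction.

Section GenericPoints.
Variables (k : fieldType) (B : idomainType) (phi : {rmorphism k -> B}).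
Hypothesis affB : finitely_generated phi.
Variables (n : nat) (psi : {rmorphism B -> {mpoly {fraction B}[n]}}).
Hypothesis psiC : forall c, psi (phi c) = (tofrac (phi c))%:MP.
Hypothesis psi_ind :
  indep_preserving phi (@mpolyC n {fraction B}) psi.
Local Notation BB := (tensor phi phi).
Local Notation K := {fraction B}.

(** The central argument: injectivity of the reduced map is checked after
composing it with a map to a field, which is an extension of the map
[kappa(p) ⊗ B -> W(X)], known to be injective. *)
Lemma generic_PE_points : exists2 d, d != 0 &
  forall p : prime_idealr B, d \notin (p : pred B) -> PE phi (toresidue p \o phi).
Proof.
have [s s0 s_den] := common_den affB psiC.
have [delta deltaE] : exists h : {rmorphism BB -> {mpoly K[n]}},
    forall a b, h (pure_tensor phi phi a b) = (tofrac a)%:MP * psi b.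
  have [|h hE] := @tensor_lift _ _ _ phi phi _
      (@mpolyC n K \o @FracField.tofrac B) psi.
    by move=> c; rewrite /= psiC.
  by exists h.
(* [R0] is the subring of [K[X]] generated by [B] and its image under [psi]. *)
have [R0 [q [j [j_inj q_surj jqE]]]] := image_domain delta.
have [R' [u [j' [j'_inj j'E X_im gu]]]] :=
  adjoin_generic [seq 'X_i | i <- enum 'I_n] j_inj.
have [a a0 ext] := gu 1 (oner_neq0 _).
have [t qt] := q_surj a.
have [m [al [b [b_ind tE]]]] := tensor_indep_rep t.
have /existsNP[l0 /eqP al0] : ~ forall l, al l = 0.
  move=> al0; case/eqP: a0; rewrite -qt tE big1 ?rmorph0 // => l _.
  by rewrite al0 pure_tensor0l.
exists (s * al l0); first by rewrite mulf_neq0.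
move=> p; rewrite prime_idealrM negb_or => /andP[sp alp].
have [psip psipE] := reduction_mod_prime sp s_den.
apply/PE_indepP; exists n, psip; split=> [c|].
  have := psipE (phi c) 0%N (phi c)%:MP; rewrite !expr0 !scale1r psiC !map_mpolyC.
  exact.
have [W [e [g eg]]] := compositum (toresidue p \o phi) affB.
have [hT hTE] : exists h : {rmorphism BB -> {mpoly W[n]}}, forall a b,
    h (pure_tensor phi phi a b) = (e (toresidue p a))%:MP * map_mpoly g (psi b).
  have [|h hE] := @tensor_lift _ _ _ phi phi _
      (@mpolyC n W \o (e \o toresidue p)) (map_mpoly g \o psi).
    by move=> c; rewrite /= psiC map_mpolyC /= -eg.
  by exists h.
have gpsi_ind : indep_preserving phi (@mpolyC n W) (map_mpoly g \o psi).
  by move=> m' b' /psi_ind; apply: mpoly_lin_indep_map.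
(* [q] is injective because [psi] preserves independence, so that [hT] factors
   through [R0]. *)
have [x|h hE] := @rmorph_factor _ _ _ q
    (@FracField.tofrac {mpoly W[n]} \o hT) q_surj.
  have [m' [a' [b' [b'_ind ->]]]] := tensor_indep_rep x.
  move=> /(congr1 j); rewrite jqE rmorph0 rmorph_sum.
  under eq_bigr => i _ do rewrite deltaE.
  move=> /(psi_ind b'_ind) a'0; rewrite !big1 ?rmorph0 // => i _.
  move: (a'0 i) => /eqP; rewrite tofrac_eq0 => /eqP->.
  by rewrite pure_tensor0l.
have ha : h a != 0.
  rewrite -qt hE /= tofrac_eq0 tE rmorph_sum.
  under eq_bigr => i _ do rewrite hTE.
  apply: contraNneq alp => /(gpsi_ind _ _ b_ind)/(_ l0)/eqP.
  by rewrite fmorph_eq0 toresidue_eq0.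
have [W' [i [h' [h'E _ _]]]] := ext _ h ha.
have /choice[y yE] l : exists r, j' r = 'X_l.
  by apply: X_im; apply: map_f; rewrite mem_enum.
have [cst cstE] : exists f : {rmorphism residue_field p -> W'},
    forall c, f c = i (tofrac (e c)%:MP).
  by exists (i \o (@FracField.tofrac {mpoly W[n]} \o (@mpolyC n W \o e))).
have [ev evC evX] : exists2 f : {rmorphism {mpoly (residue_field p)[n]} -> W'},
    forall c, f c%:MP = cst c & forall l, f 'X_l = h' (y l).
  exists (mmap cst (h' \o y)) => [c|l]; first exact: mmapC.
  by rewrite /= mmapX mmap1U.
pose inl := scalar_tensor phi phi.
(* The multiple of [psi x] by [s ^+ N] is a polynomial in the [X_l] over [B].
   This identity holds in [R'], and [h'] carries it to [W'], where [s] becomes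
   invertible because it is not in [p]. *)
have evE x : ev (psip x) = i (tofrac (map_mpoly g (psi x))).
  have [N [G xG]] := s_den x.
  have u_inl c : h' (u (q (inl c))) = cst (toresidue p c).
    by rewrite h'E hE /= hTE (rmorph1 psi) (rmorph1 (map_mpoly g)) mulr1 cstE.
  have u_inr : h' (u (q (pure_tensor phi phi 1 x))) =
      i (tofrac (map_mpoly g (psi x))).
    by rewrite h'E hE /= hTE (rmorph1 (toresidue p)) (rmorph1 e) mpolyC1 mul1r.
  have eR : u (q (inl s)) ^+ N * u (q (pure_tensor phi phi 1 x)) =
      mmap (u \o (q \o inl)) y G.
    apply: j'_inj; rewrite (@rmorph_mmap _ _ _ _ _ _ _ _
      (@mpolyC n K \o @FracField.tofrac B) (fun l => 'X_l)) //; last first.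
      by move=> c; rewrite /= j'E jqE deltaE rmorph1 mulr1.
    rewrite -[RHS]/(map_mpoly _ G) -xG rmorphM rmorphXn !j'E !jqE !deltaE.
    by rewrite rmorph1 mulr1 tofrac1 mpolyC1 mul1r -rmorphXn /= mul_mpolyC.
  have := congr1 h' eR; rewrite rmorphM rmorphXn u_inl u_inr.
  rewrite (@rmorph_mmap _ _ _ _ _ _ _ _ (cst \o toresidue p) (h' \o y)) //.
  have -> : mmap (cst \o toresidue p) (h' \o y) G = ev (map_mpoly (toresidue p) G).
    by apply/esym/rmorph_mmap => [c|l]; [apply: evC|apply: evX].
  rewrite -(psipE _ _ _ xG) -mul_mpolyC rmorphM evC rmorphXn.
  move=> /mulfI e'; apply/esym/e'.
  by rewrite expf_neq0 // fmorph_eq0 toresidue_eq0.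
move=> m' b' /gpsi_ind b'_ind c /(congr1 ev).
rewrite rmorph0 rmorph_sum => cb0 l.
apply/eqP; rewrite -(fmorph_eq0 e); apply/eqP; apply: (b'_ind (e \o c)).
apply/eqP; rewrite -tofrac_eq0 -(fmorph_eq0 i) -[X in _ == X]cb0.
rewrite !rmorph_sum; apply/eqP/eq_bigr => l' _.
by rewrite !rmorphM /= evE evC cstE.
Qed.
End GenericPoints.

Theorem corollary1p13 (k : fieldType) (B : idomainType)
    (phi : {rmorphism k -> B}) (affB : finitely_generated phi) :
  has_nonempty_interior (PE_points phi) <->
  PE phi (@FracField.tofrac B \o phi).
Proof.
split=> [[U [openU U0 UX]]|/PE_indepP[n [psi [psiC psi_ind]]]].
  have [g gE] := generic_residue B.
  apply: PE_extension (UX _ (open_generic_point openU U0)) => c.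
  exact/esym/gE.
have [d d0 dP] := generic_PE_points affB psiC psi_ind.
exists (~` zariski_closed_set [set d])%classic; split.
- by exists [set d]%classic.
- by exists (generic_point B) => /(_ d erefl) /eqP d0'; rewrite d0' eqxx in d0.
move=> p dp; apply: dP; apply/negP => dp'; apply: dp => x ->; exact: dp'.
Qed.
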